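(* Let $\Gamma$ be an infinite discrete abelian group with identity $e_\Gamma$, and let $S=\{s_1,\ldots,s_k\}\subset\Gamma$ be a finite set with $e_\Gamma\notin S$, $\langle S\rangle=\Gamma$ and $S=S^{-1}$. Let $G=\mathrm{Cay}(\Gamma,S)$. Then for every $f\in L^2(\Gamma)$ the combinatorial heat equation $$\Delta_G u(x,n)+\partial_n u(x,n)=0 \text{ on } \Gamma\times\mathbb Z_+,\qquad u(x,0)=f(x),$$ admits a unique solution, given by $u(x,n)=K_n*f(x)$, where $$K_n(x)=\chi_{\{e_\Gamma\}}(x)+\sum_{j=1}^n(-1)^j\binom{n}{j}\underbrace{h*\cdots*h}_{j\text{ times}}(x),\qquad h(x)=|S|\,\chi_{\{e_\Gamma\}}(x)-\chi_B(x),$$ and $B\subset\Gamma$ is the boundary of the unit ball centered at $e_\Gamma$ in $G$ (i.e. $B=\{x: d_G(x,e_\Gamma)=1\}=S$).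
   Context: For a connected locally finite graph $G=(V,E)$, the combinatorial Laplacian is $\Delta_G f(x)=m(x)f(x)-\sum_{y\sim x}f(y)$, where $m(x)$ is the degree of $x$; $d_G$ is the graph (shortest path) distance. The Cayley graph $\mathrm{Cay}(\Gamma,S)$ has vertex set $\Gamma$ and edges $\{x,xs\}$ for $x\in\Gamma$, $s\in S$. $\mathbb Z_+=\{0,1,2,\ldots\}$ and for $v:\mathbb Z_+\to\mathbb C$, $\partial_n v(n)=v(n+1)-v(n)$ (applied in the time variable). $L^p(\Gamma)$ is the space of $f:\Gamma\to\mathbb C$ with $\sum_{x\in\Gamma}|f(x)|^p<\infty$. Convolution: $f*g(x)=\sum_{y\in\Gamma}f(y)g(xy^{-1})$. $\chi_A$ is the indicator function of $A$. *)

(* Defs.v *)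
From HB Require Import structures.
From mathcomp Require Import all_boot all_order all_algebra finmap.
From mathcomp Require Import complex.
From mathcomp Require Import boolp classical_sets cardinality fsbigop reals ereal.
From mathcomp Require Import topology normedtype esum exp numfun.
From mathcomp Require Import summability.

Set Implicit Arguments.
Unset Strict Implicit.
Unset Printing Implicit Defensive.
Import Order.TTheory GRing.Theory Num.Theory.
Import numFieldNormedType.Exports.

Local Open Scope classical_set_scope.
Local Open Scope ring_scope.
Local Open Scope complex_scope.

Section Graphs.
Variables (V : choiceType) (adj : rel V).

Definition neighbors (x : V) : set V := [set y | adj x y].

Definition walk (x y : V) (n : nat) : Prop :=
  exists p : seq V, [/\ path adj x p, last x p = y & size p = n].

(* The default value 0 is only taken when x and y are not connected. *)
Definition graph_dist (x y : V) : nat :=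
  xget 0%N [set n | walk x y n /\ forall m, walk x y m -> (n <= m)%N].

Definition degree (x : V) : nat := #|` fset_set (neighbors x)|.

(* Both [degree] and this sum are meant for locally finite graphs: [fset_set]
   and [\sum_(_ \in _)] are junk on infinite sets. *)
Definition laplacian (K : pzRingType) (f : V -> K) (x : V) : K :=
  (degree x)%:R * f x - \sum_(y \in neighbors x) f y.

End Graphs.

Definition time_diff (K : zmodType) (v : nat -> K) (n : nat) : K :=
  v n.+1 - v n.

Definition heat_solution (V : choiceType) (adj : rel V) (K : pzRingType)
    (f : V -> K) (u : V -> nat -> K) : Prop :=
  (forall x n, laplacian adj (fun y => u y n) x + time_diff (u x) n = 0) /\
  (forall x, u x 0%N = f x).

Definition Lp (R : realType) (X : choiceType) (p : R) : set (X -> R[i]) :=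
  [set f | (\esum_(x in [set: X]) (Normc.normc (f x) `^ p)%:E < +oo)%E].

(* Abelian groups are written additively: 0 is the identity, - x the inverse,
   and x - y stands for x y^-1. *)
Section Groups.
Variable Gamma : zmodType.

Definition subgroup (H : set Gamma) : Prop :=
  [/\ H 0, forall x y, H x -> H y -> H (x + y) & forall x, H x -> H (- x)].

Definition generated_subgroup (S : set Gamma) : set Gamma := smallest subgroup S.

(* {x, y} is an edge iff it is of the form {z, z + s} with s in S. *)
Definition Cay (S : {fset Gamma}) : rel Gamma :=
  [rel x y | [exists s : S, (y == x + val s) || (x == y + val s)]].

(* [sum] is the limit of the net of finite partial sums, hence the usual sum
   whenever the family is (absolutely) summable, in particular when f or g is
   finitely supported. *)
Definition conv (R : realType) (f g : Gamma -> R[i]) (x : Gamma) : R[i] :=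
  sum (fun y : Gamma => f y * g (x - y) : R[i]^o).

(* The j-fold convolution h * ... * h, for 1 <= j. *)
Definition conv_iter (R : realType) (j : nat) (h : Gamma -> R[i]) :
  Gamma -> R[i] := iterop j (@conv R) h (\1_[set 0]).

Definition unit_sphere (S : {fset Gamma}) : set Gamma :=
  [set x | graph_dist (Cay S) x 0 = 1%N].

Definition hker (R : realType) (S : {fset Gamma}) (x : Gamma) : R[i] :=
  #|` S|%:R * \1_[set 0] x - \1_(unit_sphere S) x.

Definition heat_kernel (R : realType) (S : {fset Gamma}) (n : nat) (x : Gamma) :
    R[i] :=
  \1_[set 0] x +
  \sum_(1 <= j < n.+1) (-1) ^+ j * 'C(n, j)%:R * conv_iter j (@hker R S) x.

End Groups.

(* Main.v *)
(* With h finitely supported, the Laplacian of Cay(Gamma, S) is f |-> h * f, so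
   the heat equation is the explicit recursion
   u(., n + 1) = u(., n) - h * u(., n), which determines u from f.  Expanding
   its n-th iterate by the binomial theorem, and using that convolution of
   finitely supported functions is associative, turns it into K_n * f. *)
Require Import Defs.
From HB Require Import structures.
From mathcomp Require Import all_boot all_order all_algebra finmap.
From mathcomp Require Import complex.
From mathcomp Require Import boolp classical_sets cardinality reals.
From mathcomp Require Import fsbigop topology normedtype numfun.
From mathcomp Require Import summability.

Set Implicit Arguments.
Unset Strict Implicit.
Unset Printing Implicit Defensive.

Local Open Scope classical_set_scope.
Local Open Scope ring_scope.
Local Open Scope complex_scope.

Import Order.TTheory GRing.Theory Num.Theory.
Import numFieldNormedType.Exports.

(** The partial sums over finite sets containing [A] all agree, so the net is eventually
    constant. *)
Lemma sum_finite (I : choiceType) (K : numFieldType) (V : normedModType K)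
    (A : {fset I}) (x : I -> V) :
  (forall i, i \notin A -> x i = 0) -> sum x = \sum_(i <- A) x i.
Proof.
move=> x0; apply: (lim_near_cst (@norm_hausdorff _ V)).
  exact: totally_filter.
exists A => //= B AB; rewrite /partial_sum -(big_seq_fsetE _ B predT x).
by rewrite -(big_fset_incl _ AB)// => i _ /x0.
Qed.

Section Convolution.
Variables (R : realType) (Gamma : zmodType).
Implicit Types (f g h : Gamma -> R[i]) (x y : Gamma).

Definition finitely_supported g :=
  exists A : {fset Gamma}, forall y, y \notin A -> g y = 0.

Lemma convE (A : {fset Gamma}) g f x : (forall y, y \notin A -> g y = 0) ->
  conv g f x = \sum_(y <- A) g y * f (x - y).
Proof.
by move=> g0; apply: (@sum_finite _ _ R[i]^o) => y /g0 ->; rewrite mul0r.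
Qed.

(** Summing over the whole group instead of a chosen support lets the sum be reindexed by a
    translation. *)
Lemma conv_fsumE g f x : finitely_supported g ->
  conv g f x = \sum_(y \in setT) g y * f (x - y).
Proof.
by case=> A g0; rewrite (convE _ _ g0) (fsbigTE A)// => y /g0 ->; rewrite mul0r.
Qed.

Lemma delta_neq0 y : y != 0 -> \1_[set 0] y = 0 :> R[i].
Proof. by move=> y0; rewrite indicE memNset//=; exact/eqP. Qed.

Lemma finitely_supported_delta : finitely_supported \1_[set 0].
Proof. by exists [fset 0]%fset => y; rewrite inE; exact: delta_neq0. Qed.

Lemma finitely_supported_lin a g h : finitely_supported g ->
  finitely_supported h -> finitely_supported (fun x => a * g x + h x).
Proof.
move=> [A gA] [B hB]; exists (A `|` B)%fset => y.
by rewrite inE negb_or => /andP[/gA -> /hB ->]; rewrite mulr0 addr0.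
Qed.

Lemma finitely_supported_sum (I : Type) (r : seq I) (c : I -> R[i])
    (G : I -> Gamma -> R[i]) : (forall i, finitely_supported (G i)) ->
  finitely_supported (fun x => \sum_(i <- r) c i * G i x).
Proof.
move=> fG; elim: r => [|i r IH].
  by exists fset0 => y _; rewrite big_nil.
have [A E] := finitely_supported_lin (c i) (fG i) IH.
by exists A => y /E; rewrite big_cons.
Qed.

Lemma finitely_supported_shift g s : finitely_supported g ->
  finitely_supported (fun x => g (x - s)).
Proof.
case=> A gA; exists [fset (y + s)%R | y in A]%fset => y yA.
apply: gA; apply: contra yA => yA.
by apply/imfsetP; exists (y - s); rewrite ?subrK.
Qed.

Lemma conv_suml (I : Type) (r : seq I) (c : I -> R[i])
    (G : I -> Gamma -> R[i]) f x : (forall i, finitely_supported (G i)) ->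
  conv (fun z => \sum_(i <- r) c i * G i z) f x =
  \sum_(i <- r) c i * conv (G i) f x.
Proof.
move=> fG; elim: r => [|i r IH].
  by rewrite (@convE fset0) ?big_nil// => y _; rewrite big_nil.
have [B HB] := finitely_supported_sum r c fG; have [A HA] := fG i.
(* A common support, so that all three convolutions become sums over one index set. *)
pose C := (A `|` B)%fset.
have GC y : y \notin C -> G i y = 0.
  by rewrite inE negb_or => /andP[/HA].
have rC y : y \notin C -> \sum_(i <- r) c i * G i y = 0.
  by rewrite inE negb_or => /andP[_ /HB].
rewrite big_cons -IH (convE _ _ GC) (convE _ _ rC) (@convE C).
  rewrite mulr_sumr -big_split; apply: eq_bigr => y _ /=.
  by rewrite big_cons mulrDl mulrA.
by move=> y yC; rewrite big_cons GC// rC// mulr0 addr0.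
Qed.

Lemma conv_shift g f s x : finitely_supported g ->
  conv (fun z => g (z - s)) f x = conv g f (x - s).
Proof.
move=> fg; rewrite !conv_fsumE//; last exact: finitely_supported_shift.
have bij : bijective (fun y => y + s).
  by exists (fun y => y - s) => y; rewrite ?addrK ?subrK.
rewrite (reindex_fsbigT _ _ bij).
by apply: eq_fsbigr => y _ /=; rewrite addrK opprD (addrC (- y)) addrA.
Qed.

Lemma finitely_supported_conv h g : finitely_supported h ->
  finitely_supported g -> finitely_supported (conv h g).
Proof.
move=> [A hA] fg.
rewrite (_ : conv h g = fun x => \sum_(y <- A) h y * g (x - y)).
  by apply: finitely_supported_sum => y; exact: finitely_supported_shift.
by apply/funext => x; exact: convE.
Qed.

(* [h * g] is a finite combination of translates of [g], and convolution by [f]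
   is linear and commutes with translations. *)
Lemma conv_assoc h g f : finitely_supported h -> finitely_supported g ->
  conv (conv h g) f = conv h (conv g f).
Proof.
move=> [A hA] fg; apply/funext => x.
rewrite (_ : conv h g = fun x => \sum_(y <- A) h y * g (x - y)); last first.
  by apply/funext => z; exact: convE.
rewrite (conv_suml _ _ (G := fun y z => g (z - y))); last first.
  by move=> y; exact: finitely_supported_shift.
by rewrite (convE _ _ hA); apply: eq_bigr => y _; rewrite conv_shift.
Qed.

Lemma conv_delta f : conv \1_[set 0] f = f.
Proof.
apply/funext => x; rewrite (@convE [fset 0]%fset).
  by rewrite big_seq_fset1 indicE mem_set// mul1r subr0.
by move=> y; rewrite inE; exact: delta_neq0.
Qed.

Lemma convBr h f g : finitely_supported h ->
  conv h (fun x => f x - g x) = fun x => conv h f x - conv h g x.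
Proof.
move=> [A hA]; apply/funext => x; rewrite !(convE _ _ hA) -sumrB.
by apply: eq_bigr => y _; rewrite mulrBr.
Qed.

Lemma finitely_supported_conv_iter j h : finitely_supported h ->
  finitely_supported (conv_iter j h).
Proof.
move=> fh; case: j => [|j]; first exact: finitely_supported_delta.
elim: j => // j IH; exact: finitely_supported_conv.
Qed.

Lemma conv_conv_iter j h f : finitely_supported h ->
  conv (conv_iter j h) f = iter j (conv h) f.
Proof.
(* [iterop] yields the delta at exponent 0 but [h] itself, with no trailing delta, at exponent 1;
   hence the induction starts at 1. *)
move=> fh; case: j => [|j]; first exact: conv_delta.
elim: j => // j IH; rewrite iterS -IH -conv_assoc//.
exact: finitely_supported_conv_iter.
Qed.

(** The heat equation solved for the next time: an explicit Euler scheme with unit step. *)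
Definition euler_step h f x := f x - conv h f x.

Lemma iter_convB j h f g : finitely_supported h ->
  iter j (conv h) (fun x => f x - g x) =
  fun x => iter j (conv h) f x - iter j (conv h) g x.
Proof. by move=> fh; elim: j => // j IH; rewrite iterS IH convBr. Qed.

(** Binomial expansion of the [n]-th power of the identity minus [conv h]. The induction peels off
    the innermost step, so [f] must stay general, and concludes by Pascal's rule. *)
Lemma iter_euler_step n h f x : finitely_supported h ->
  iter n (euler_step h) f x =
  \sum_(0 <= j < n.+1) (-1) ^+ j * 'C(n, j)%:R * iter j (conv h) f x.
Proof.
move=> fh; elim: n f => [|n IH] f; first by rewrite big_nat1 bin0 !mul1r.
rewrite iterSr IH.
under eq_bigr do rewrite iter_convB// -iterSr mulrBr.
rewrite sumrB big_nat_recl// [in RHS]big_nat_recl//.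
(* The range is extended by the term [j = n], which vanishes since ['C(n, n.+1)] is 0; both sums
   then have the same range. *)
rewrite [X in _ + X - _](_ : _ = \sum_(0 <= j < n.+1)
  (-1) ^+ j.+1 * 'C(n, j.+1)%:R * iter j.+1 (conv h) f x); last first.
  by rewrite [RHS]big_nat_recr//= bin_small// mulr0 mul0r addr0.
rewrite !bin0 -addrA -sumrB; congr (_ + _); apply: eq_bigr => j _.
by rewrite binS natrD mulrDr mulrDl exprS mulN1r !mulNr.
Qed.

End Convolution.

Section CayleyGraph.
Variables (R : realType) (Gamma : zmodType) (S : {fset Gamma}).
Hypotheses (S_id : 0 \notin S) (S_sym : [fset - s | s in S]%fset = S).

Lemma oppS s : (- s \in S) = (s \in S).
Proof.
have H t : t \in S -> - t \in S.
  by move=> tS; rewrite -S_sym; apply/imfsetP; exists t.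
by apply/idP/idP => /H; rewrite ?opprK.
Qed.

(** Symmetry of [S] merges the two orientations of an edge. *)
Lemma CayE x y : Cay S x y = (x - y \in S).
Proof.
apply/existsP/idP => [[s /orP[]/eqP->]|xyS].
- by rewrite opprD addrA subrr sub0r oppS; exact: valP.
- by rewrite addrAC subrr add0r; exact: valP.
- by exists [` xyS]%fset; rewrite /= [y + _]addrC subrK eqxx orbT.
Qed.

Lemma unit_sphereE : unit_sphere S = [set` S].
Proof.
(* A distance equal to 1 cannot be the default value 0 of [xget], so it is the length of an actual
   walk. *)
apply/seteqP; split=> x /=; rewrite /unit_sphere /graph_dist /=.
  case: xgetP => // n _ [[p [+ + <-]] _].
  case: p => [|y []]//=; rewrite andbT CayE => xyS y0 _.
  by rewrite y0 subr0 in xyS.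
(* The edge from [x] to 0 bounds the minimum by 1, and length 0 would force [x = 0], against [S_id].
   The default case is refuted because 1 is itself a minimal length. *)
move=> xS; case: xgetP => [n _ [[p [xp p0 sp]] nmin]|/(_ 1%N)[]].
  have : walk (Cay S) x 0 1 by exists [:: 0]; rewrite /= CayE subr0 xS.
  move=> /nmin; case: n sp {nmin} => [|[]]// /size0nil p_nil.
  by move: p0 S_id xS; rewrite p_nil /= => -> /negPf->.
split; first by exists [:: 0]; rewrite /= CayE subr0 xS.
case=> // -[p [_ + /size0nil p_nil]]; rewrite p_nil /= => x0.
by move: S_id xS; rewrite x0 => /negPf->.
Qed.

Lemma hker_out x : x \notin (0 |` S)%fset -> hker R S x = 0.
Proof.
rewrite !inE negb_or => /andP[x0 xS].
rewrite /hker unit_sphereE !indicE memNset ?memNset ?mulr0 ?subrr//=.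
  exact/negP.
exact/eqP.
Qed.

Lemma finitely_supported_hker : finitely_supported (@hker Gamma R S).
Proof. by exists (0 |` S)%fset; exact: hker_out. Qed.

(** The kernel is the degree at 0 and -1 on [S]; as 0 lies outside [S], these give the diagonal term
    and the neighbor sum separately. *)
Lemma laplacian_conv (f : Gamma -> R[i]) x :
  laplacian (Cay S) f x = conv (hker R S) f x.
Proof.
have inj : injective (fun s => x - s) by move=> s t /addrI/oppr_inj.
(* Neighbors are written [x - s] to match the argument of [f] in the convolution. *)
have nE : neighbors (Cay S) x = [set` [fset (x - s)%R | s in S]%fset].
  apply/seteqP; split=> y /=; rewrite /neighbors /= CayE.
    by move=> xyS; apply/imfsetP; exists (x - y); rewrite ?subKr.
  by move=> /imfsetP[s sS ->]; rewrite subKr.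
rewrite /laplacian /degree nE set_fsetK card_imfset//.
rewrite (convE _ _ hker_out) big_fsetU1//= -fsbig_seq//.
rewrite big_imfset/=; last by move=> ? ? _ _; exact: inj.
rewrite -sumrN; congr (_ + _).
  rewrite /hker unit_sphereE !indicE mem_set// memNset/= ?subr0 ?mulr1//.
  exact/negP.
apply: eq_big_seq => s sS; rewrite /hker unit_sphereE !indicE memNset.
  by rewrite mem_set// mulr0 sub0r mulN1r.
by move=> /= s0; move: S_id; rewrite -s0 sS.
Qed.

(** This equivalence yields existence and uniqueness together: a solution is exactly the orbit of
    [f] under the Euler step. *)
Lemma heat_solutionE (f : Gamma -> R[i]) u :
  heat_solution (Cay S) f u <->
  forall n, u ^~ n = iter n (euler_step (hker R S)) f.
Proof.
split=> [[uS u0] n|uE].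
  elim: n => [|n IH]; apply/funext => x; rewrite ?u0//= -IH /euler_step.
  have /eqP := uS x n; rewrite laplacian_conv /time_diff addrC addr_eq0.
  by rewrite subr_eq addrC => /eqP.
have uxE x n : u x n = iter n (euler_step (hker R S)) f x by rewrite -uE.
split=> [x n|x]; last exact: uxE.
rewrite uE laplacian_conv /time_diff !uxE iterS /euler_step.
by rewrite addrAC subrr sub0r subrr.
Qed.

Lemma conv_heat_kernel (f : Gamma -> R[i]) n x :
  conv (heat_kernel R S n) f x = iter n (euler_step (hker R S)) f x.
Proof.
have fh := finitely_supported_hker.
rewrite iter_euler_step//.
(* The isolated delta is the term [j = 0], since [conv_iter 0] is the delta. *)
rewrite (_ : heat_kernel R S n = fun z => \sum_(0 <= j < n.+1)
    (-1) ^+ j * 'C(n, j)%:R * conv_iter j (@hker Gamma R S) z); last first.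
  by apply/funext => z; rewrite /heat_kernel [RHS]big_ltn// bin0 !mul1r.
rewrite conv_suml; last by move=> j; exact: finitely_supported_conv_iter.
by apply: eq_bigr => j _; rewrite conv_conv_iter.
Qed.

End CayleyGraph.

Theorem theorem2p1 (R : realType) (Gamma : zmodType) (S : {fset Gamma})
    (Gamma_infinite : infinite_set [set: Gamma])
    (S_id : 0 \notin S)
    (S_gen : generated_subgroup [set` S] = [set: Gamma])
    (S_sym : [fset - s | s in S]%fset = S) :
  unit_sphere S = [set` S] /\
  forall f : Gamma -> R[i], Lp 2 f ->
    unique (heat_solution (Cay S) f)
           (fun (x : Gamma) (n : nat) => conv (heat_kernel R S n) f x).
Proof.
split; first exact: unit_sphereE.
move=> f _; split=> [|u /(heat_solutionE S_id S_sym) uE].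
  apply/(heat_solutionE S_id S_sym) => n; apply/funext => x.
  exact: conv_heat_kernel.
apply/funext => x; apply/funext => n.
by rewrite conv_heat_kernel// -uE.
Qed.
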